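(* Let $\psi$ be a quasiperiodic flow on $T^2$ (generated by a constant vector field) and let $F$ be a real quadratic number field. If $M_\psi$ is a finite index subgroup of $\mathfrak{o}_F^*$, then $\psi$ is $F$-algebraic.
   Context: $T^2=\mathbb{R}^2/\mathbb{Z}^2$ is the $2$-torus with global coordinates $(\theta_1,\theta_2)$. For a smooth ($C^\infty$) flow $\psi:\mathbb{R}\times T^2\to T^2$, its generating vector field is $X_\psi(p)=\frac{d}{dt}\psi(t,p)|_{t=0}$. A constant vector field is one of the form $a_1\,\partial/\partial\theta_1+a_2\,\partial/\partial\theta_2$ with $a_1,a_2\in\mathbb{R}$. A flow generated by a constant vector field is quasiperiodic if the components $a_1,a_2$ are linearly independent over $\mathbb{Q}$. Generalized symmetry group: $S_\psi$ is the group of all $R\in\mathrm{Diff}(T^2)$ (smooth diffeomorphisms) for which there is $\alpha\in\mathbb{R}^*=\mathbb{R}\setminus\{0\}$ with $R_*X_\psi=\alpha X_\psi$, where $R_*X_\psi=\mathbf{T}R\,X_\psi\,R^{-1}$ is the push-forward and $\mathbf{T}R$ is the derivative map of $R$. The unique such $\alpha$ is the multiplier $\rho_\psi(R)$, and the multiplier group is $M_\psi=\rho_\psi(S_\psi)\subset\mathbb{R}^*$. A real quadratic number field is a subfield $F$ of $\mathbb{R}$ of degree $2$ over $\mathbb{Q}$. A quasiperiodic flow $\psi$ on $T^2$ generated by $X_\psi=a_1\,\partial/\partial\theta_1+a_2\,\partial/\partial\theta_2$ is called $F$-algebraic if there is $\vartheta\in\mathbb{R}^*$ such that $\{\vartheta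 a_1,\vartheta a_2\}$ is a $\mathbb{Q}$-basis of $F$. $\mathfrak{o}_F$ denotes the ring of algebraic integers in $F$ and $\mathfrak{o}_F^*$ its group of units. *)

(* Defs.v *)
From HB Require Import structures.
From mathcomp Require Import all_boot all_order all_algebra.
From mathcomp Require Import generic_quotient ring_quotient.
From mathcomp Require Import boolp classical_sets functions cardinality reals.
From mathcomp Require Import topology normedtype derive.

Set Implicit Arguments.
Unset Strict Implicit.
Unset Printing Implicit Defensive.

Import Order.TTheory GRing.Theory Num.Theory.
Import numFieldNormedType.Exports.
Local Open Scope classical_set_scope.
Local Open Scope ring_scope.
Local Open Scope quotient_scope.

Definition int_lattice (R : realType) : zmodClosed 'rV[R]_2 :=
  GRing.ZmodClosed.clone _
    (mxOver_pred (m := 1) (n := 2) (@Num.int_num_subdef R)) _.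

Lemma int_latticeE (R : realType) (x : 'rV[R]_2) :
  (x \in int_lattice R) = (x \is a mxOver Num.int).
Proof. by []. Qed.

Definition torus (R : realType) := Quotient.quot (int_lattice R).

Definition torus_proj (R : realType) (x : 'rV[R]_2) : torus R :=
  \pi_(torus R) x.

(* Only used on open sets U, where the value of 'D_v f on U depends only on
   the restriction of f to U. *)
Fixpoint Ck_on (R : realType) (V W : normedModType R) (k : nat) (U : set V)
    (f : V -> W) : Prop :=
  match k with
  | 0 => forall x, U x -> {for x, continuous f}
  | k'.+1 => (forall x, U x -> differentiable f x) /\
             (forall v : V, Ck_on k' U (fun x => 'D_v f x))
  end.

Definition smooth_on (R : realType) (V W : normedModType R) (U : set V)
    (f : V -> W) : Prop :=
  forall k, Ck_on k U f.

(* The charts of the torus are the local inverses of torus_proj, so a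
   torus-valued map is smooth when it lifts, near each point, to a smooth map
   into R^2. *)
Definition smooth_to_torus (R : realType) (V : normedModType R)
    (h : V -> torus R) : Prop :=
  forall x : V, exists (U : set V) (g : V -> 'rV[R]_2),
    [/\ open U, U x, smooth_on U g & forall y, U y -> torus_proj (g y) = h y].

(* The derivative at x of a torus-valued map, read in the global coordinates
   (theta_1, theta_2), which identify every tangent space of the torus with
   R^2: the differential of any local lift (two lifts differentiable at x
   differ by a constant near x); 0 by convention if there is none. *)
Definition torus_diff (R : realType) (V : normedModType R)
    (h : V -> torus R) (x : V) : V -> 'rV[R]_2 :=
  xget (fun=> 0) [set L : V -> 'rV[R]_2 | exists g : V -> 'rV[R]_2,
    [/\ (\forall y \near x, torus_proj (g y) = h y),
        differentiable g x & L = 'd g x :> (V -> 'rV[R]_2)]].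

(* Smoothness of a map on the torus is tested after composition with
   torus_proj, which is a local diffeomorphism. *)
Definition torus_smooth (R : realType) (f : torus R -> torus R) : Prop :=
  smooth_to_torus (fun x : 'rV[R]_2 => f (torus_proj x)).

Definition tangent_map (R : realType) (f : torus R -> torus R) (p : torus R) :
    'rV[R]_2 -> 'rV[R]_2 :=
  torus_diff (fun x : 'rV[R]_2 => f (torus_proj x)) (repr p).

Record torus_diffeo (R : realType) := TorusDiffeo {
  diffeo_fun :> torus R -> torus R;
  diffeo_inv : torus R -> torus R;
  diffeo_funK : cancel diffeo_fun diffeo_inv;
  diffeo_invK : cancel diffeo_inv diffeo_fun;
  diffeo_smooth : torus_smooth diffeo_fun;
  diffeo_inv_smooth : torus_smooth diffeo_inv }.

Definition vector_field (R : realType) := torus R -> 'rV[R]_2.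

Definition pushforward (R : realType) (f : torus_diffeo R)
    (X : vector_field R) : vector_field R :=
  fun p => tangent_map f (diffeo_inv f p) (X (diffeo_inv f p)).

Definition smooth_flow (R : realType) (psi : R -> torus R -> torus R) : Prop :=
  [/\ forall p, psi 0 p = p,
      forall s t p, psi (s + t) p = psi s (psi t p) &
      smooth_to_torus
        (fun z : R^o * 'rV[R]_2 => psi z.1 (torus_proj z.2))].

Definition generating_field (R : realType) (psi : R -> torus R -> torus R) :
    vector_field R :=
  fun p => torus_diff (fun t : R^o => psi t p) 0 1.

Definition constant_field (R : realType) (a : 'rV[R]_2) : vector_field R :=
  fun=> a.

Definition rat_independent (R : realType) (u v : R) : Prop :=
  forall r s : rat, ratr r * u + ratr s * v = 0 -> r = 0 /\ s = 0.

Definition quasiperiodic_flow (R : realType) (psi : R -> torus R -> torus R) :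
    Prop :=
  smooth_flow psi /\
  exists a : 'rV[R]_2, generating_field psi = constant_field a /\
    rat_independent (a 0 0) (a 0 1).

Definition symmetry_group (R : realType) (psi : R -> torus R -> torus R) :
    set (torus_diffeo R) :=
  [set f | exists2 alpha : R, alpha != 0 &
    pushforward f (generating_field psi) =
      fun p => alpha *: generating_field psi p].

Definition multiplier (R : realType) (psi : R -> torus R -> torus R)
    (f : torus_diffeo R) : R :=
  xget 0 [set alpha : R | alpha != 0 /\
    pushforward f (generating_field psi) =
      fun p => alpha *: generating_field psi p].

Definition multiplier_group (R : realType) (psi : R -> torus R -> torus R) :
    set R :=
  multiplier psi @` symmetry_group psi.

Definition rat_basis (R : realType) (F : {pred R}) (u v : R) : Prop :=
  [/\ u \in F, v \in F, rat_independent u v &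
      forall x, x \in F -> exists r s : rat, x = ratr r * u + ratr s * v].

Definition real_quadratic_field (R : realType) (F : {pred R}) : Prop :=
  divring_closed F /\ exists u v : R, rat_basis F u v.

Definition ring_of_integers (R : realType) (F : {pred R}) : set R :=
  [set x | x \in F /\ integralOver (intr : int -> R) x].

Definition integer_units (R : realType) (F : {pred R}) : set R :=
  [set x | [/\ x != 0, ring_of_integers F x & ring_of_integers F x^-1]].

(* H and G are subsets of the multiplicative group of R; the index is the
   number of cosets u H with u in G. *)
Definition finite_index_subgroup (R : realType) (H G : set R) : Prop :=
  [/\ H `<=` G, H 1, (forall x y, H x -> H y -> H (x / y)) &
      finite_set [set [set u * h | h in H] | u in G]].

Definition algebraic_flow (R : realType) (F : {pred R})
    (psi : R -> torus R -> torus R) : Prop :=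
  quasiperiodic_flow psi /\
  exists a : 'rV[R]_2, generating_field psi = constant_field a /\
    exists2 vartheta : R, vartheta != 0 &
      rat_basis F (vartheta * a 0 0) (vartheta * a 0 1).

(* Main.v *)
Require Import Defs.
From mathcomp Require Import all_boot all_order all_algebra.
From mathcomp Require Import classical_sets reals.
From mathcomp Require Import generic_quotient ring_quotient.
From mathcomp Require Import boolp functions cardinality.
From mathcomp Require Import topology normedtype derive.
From mathcomp Require Import ring lra zify.

(** Pell's equation makes the unit group of F infinite, so a finite index
    subgroup contains an irrational unit alpha. If a diffeomorphism f multiplies
    the constant field a by alpha, then f maps the orbit x + t a to
    f(x) + t alpha a. Since the orbit of 0 is dense, f is affine: its derivative
    L at 0 preserves Z^2 and satisfies L a = alpha a. With integers b, c this
    reads alpha a_1 = b a_1 + c a_2, where c <> 0 because alpha is irrational,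
    so the slope a_2 / a_1 = (alpha - b) / c lies in F. *)

Set Implicit Arguments.
Unset Strict Implicit.
Unset Printing Implicit Defensive.

Import Order.TTheory GRing.Theory Num.Theory.
Import numFieldNormedType.Exports.
Local Open Scope classical_set_scope.
Local Open Scope ring_scope.

(** * Diophantine approximation and Pell's equation *)

Lemma nat_pigeonhole (T : finType) (h : nat -> T) :
  exists i j : nat, [/\ (i < j)%N, (j <= #|T|)%N & h i = h j].
Proof.
have /injectivePn [i [j ij hij]] : ~~ injectiveb (fun i : 'I_#|T|.+1 => h i).
  apply/injectiveP => /leq_card; rewrite card_ord; lia.
wlog ltij : i j ij hij / (i < j)%N.
  move=> W; have [ltij|ltji|eqij] := ltngtP i j; first exact: W hij ltij.
    by apply: (W j i) => //; rewrite eq_sym.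
  by move/val_inj: eqij ij => ->; rewrite eqxx.
by exists i, j; split => //; have := ltn_ord j.
Qed.

(** Among the N + 1 fractional parts of 0, b, ..., N b, two fall into the same of N boxes of width 1
    / N; the difference of their indices is [q]. *)
Lemma dirichlet_approximation (R : realType) (b : R) (N : nat) : (0 < N)%N ->
  exists (p : int) (q : nat), [/\ (0 < q)%N, (q <= N)%N &
    `|q%:R * b - p%:~R| * N%:R < 1].
Proof.
case: N => // N _.
pose fr (i : nat) : R := i%:R * b - (Num.floor (i%:R * b))%:~R.
have fr_ge0 i : 0 <= fr i by rewrite subr_ge0 floor_le.
have fr_lt1 i : fr i < 1.
  by rewrite ltrBlDl -[X in _ + X]/(1%:~R) -intrD floorD1_gt.
pose z i := Num.floor (N.+1%:R * fr i).
have z_ge0 i : (0 <= z i)%R by rewrite floor_ge0 mulr_ge0.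
have z_lt i : (`|z i| < N.+1)%N.
  rewrite -ltz_nat gez0_abs // -(ltr_int R).
  apply: le_lt_trans (floor_le _) _.
  by rewrite -[ltRHS]mulr1 ltr_pM2l ?ltr0Sn.
have [i [j [ltij lejN hij]]] := nat_pigeonhole (fun i => Ordinal (z_lt i)).
rewrite card_ord in lejN.
have {}hij : z i = z j.
  by move/(congr1 val): hij => /= /(congr1 Posz); rewrite !gez0_abs.
exists (Num.floor (j%:R * b) - Num.floor (i%:R * b)), (j - i)%N; split.
- by rewrite subn_gt0.
- by rewrite (leq_trans (leq_subr _ _)).
have -> : (j - i)%:R * b - (Num.floor (j%:R * b) - Num.floor (i%:R * b))%:~R
    = fr j - fr i.
  by rewrite /fr natrB ?(ltnW ltij) // intrB; ring.
have Fi := floor_le (N.+1%:R * fr i); have Fj := floor_le (N.+1%:R * fr j).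
have Gi := floorD1_gt (N.+1%:R * fr i); have Gj := floorD1_gt (N.+1%:R * fr j).
rewrite -/(z _) in Fi Fj Gi Gj; rewrite !intrD hij in Fi Fj Gi Gj.
have N0 : 0 <= N.+1%:R :> R by [].
rewrite -[X in _ * X](ger0_norm N0) -normrM ltr_norml mulrBl.
rewrite ![_ * N.+1%:R]mulrC; lra.
Qed.

Lemma intr_pell (R : pzRingType) (D : nat) (p q : int) :
  (p ^+ 2 - D%:Z * q ^+ 2)%:~R = p%:~R ^+ 2 - D%:R * q%:~R ^+ 2 :> R.
Proof. by rewrite intrB intrM !rmorphXn. Qed.

(** With x = q d - p, the norm p^2 - D q^2 equals x^2 - 2 d q x. Dirichlet's bounds |x| N < 1 and q
    <= N keep it within 1 + 2 d, a bound that does not depend on [e]. *)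
Lemma small_norm_approximation (R : realType) (d : R) (D : nat) (e : R) :
  0 < d -> d ^+ 2 = D%:R -> 0 < e ->
  exists p q : int, [/\ 0 < q, `|q%:~R * d - p%:~R| < e &
    `|p ^+ 2 - D%:Z * q ^+ 2| <= Num.floor (1 + 2 * d)].
Proof.
move=> d0 dD e0.
pose N := (Num.truncn e^-1).+1.
have eN : 1 < e * N%:R.
  by rewrite -(@ltr_pM2l _ e^-1) ?invr_gt0 // mulr1 mulKf ?gt_eqF // truncnS_gt.
have N0 : 1 <= N%:R :> R by rewrite ler1n.
have [p [q [q0 qN pq]]] := dirichlet_approximation d (ltn0Sn _ : (0 < N)%N).
exists p, q%:Z; split => //.
  rewrite -pmulrn; set x := `|_| in pq *.
  rewrite ltNge; apply/negP => ex.
  have : e * N%:R <= x * N%:R by rewrite ler_wpM2r // (le_trans ler01).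
  lra.
rewrite floor_ge_int intr_norm intr_pell -!pmulrn.
have -> : p%:~R ^+ 2 - D%:R * q%:R ^+ 2
    = (q%:R * d - p%:~R) ^+ 2 - 2 * d * (q%:R * (q%:R * d - p%:~R)).
  by rewrite -dD; ring.
set x := _ - _ in pq *.
have x0 : 0 <= `|x| by [].
have qN' : q%:R <= N%:R :> R by rewrite ler_nat.
have q0' : 0 <= q%:R :> R by [].
apply: le_trans (ler_normB _ _) _; rewrite normrX !normrM.
rewrite (gtr0_norm d0) (ger0_norm q0') (ger0_norm (ler0n _ 2)).
have h1 : `|x| <= `|x| * N%:R by rewrite ler_peMr.
have h2 : q%:R * `|x| <= `|x| * N%:R by rewrite mulrC ler_wpM2l.
apply: lerD; first by rewrite expr_le1 //; lra.
by rewrite -[leRHS]mulr1 ler_wpM2l //; lra.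
Qed.

Lemma eq_modz_dvdz (d m n : int) : (m %% d)%Z = (n %% d)%Z -> (d %| m - n)%Z.
Proof. by move=> /eqP; rewrite eqz_mod_dvd. Qed.

(** Ever better approximations give infinitely many pairs of bounded norm. Two of them share the
    norm m and the residues modulo m, and then the quotient of p - q d by p' - q' d has integer
    coefficients and norm 1. *)
Lemma pell_solution (R : realType) (d : R) (D : nat) :
  0 < d -> d ^+ 2 = D%:R ->
  (forall p q : int, p%:~R = q%:~R * d -> q = 0) ->
  exists x y : int, [/\ 0 < x, 0 < y & x ^+ 2 - D%:Z * y ^+ 2 = 1].
Proof.
move=> d0 dD irr.
pose K := `|Num.floor (1 + 2 * d)|%N.
have KE : K%:Z = Num.floor (1 + 2 * d).
  by rewrite gez0_abs // floor_ge0; lra.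
pose v (s : int * int) : R := `|s.2%:~R * d - s.1%:~R|.
pose n (s : int * int) : int := s.1 ^+ 2 - D%:Z * s.2 ^+ 2.
have /choice [F FP] (e : R) : exists s : int * int,
    0 < e -> [/\ 0 < s.2, v s < e & `|n s| <= K%:Z].
  case: (ltP 0 e) => [e0|_]; last by exists (0, 0).
  have [p [q [h1 h2 h3]]] := small_norm_approximation d0 dD e0.
  by exists (p, q) => _; rewrite KE.
have v_gt0 s : 0 < s.2 -> 0 < v s.
  move=> s0; rewrite normr_gt0 subr_eq0; apply: contraTneq s0 => /esym /irr ->.
  by rewrite ltxx.
(* Each pair is chosen to beat the previous value of [v], which is positive because d is irrational;
   so [v] strictly decreases along the sequence. *)
pose s k := iter k (fun s => F (v s)) (F 1).
have sP k : 0 < (s k).2 /\ `|n (s k)| <= K%:Z.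
  elim: k => [|k [IH _]]; first by have [] := FP 1 ltr01.
  by rewrite /s iterS -/(s k); have [] := FP _ (v_gt0 _ IH).
have v_decr i j : (i < j)%N -> v (s j) < v (s i).
  have dS k : v (s k.+1) < v (s k).
    by rewrite /s iterS -/(s k); have [] := FP _ (v_gt0 _ (sP k).1).
  elim: j => // j IH; rewrite ltnS leq_eqVlt => /orP[/eqP ->|/IH];
    first exact: dS.
  by apply: lt_trans; apply: dS.
have n_neq0 k : n (s k) != 0.
  apply/eqP => nk0; have := (sP k).1; have := v_gt0 _ (sP k).1.
  case: (s k) nk0 => p q; rewrite /n /v /= => /eqP;
    rewrite subr_eq0 => /eqP E vq q0.
  have : p%:~R ^+ 2 = (q%:~R * d) ^+ 2 :> R.
    by rewrite exprMn dD -rmorphXn E rmorphM rmorphXn /= -pmulrn mulrC.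
  move/eqP; rewrite eqf_sqr => /orP[/eqP /irr|]; first by lia.
  by rewrite -mulNr -intrN => /eqP /irr; lia.
(* The norm lies between -K and K, so adding [K] makes it a natural number; residues modulo a
   nonzero norm are at most [K]. *)
pose h k : 'I_(K + K).+1 * ('I_K.+1 * 'I_K.+1) :=
  (inord (absz (n (s k) + K%:Z)),
   (inord `|((s k).1 %% n (s k))%Z|%N, inord `|((s k).2 %% n (s k))%Z|%N)).
have [i [j [ij _ [hn hp hq]]]] := nat_pigeonhole h.
have Kn k : (absz (n (s k)) <= K)%N by have := (sP k).2; lia.
have {}hn : n (s i) = n (s j).
  move/(congr1 val): hn; rewrite /= !inordK; have := (sP i).2;
    have := (sP j).2; lia.
have resK k (z : int) : (absz (z %% n (s k))%Z < K.+1)%N.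
  have := ltz_mod z (n_neq0 k); have := modz_ge0 z (n_neq0 k); have := Kn k;
    lia.
have {}hp : ((s i).1 %% n (s i))%Z = ((s j).1 %% n (s i))%Z.
  move/(congr1 val): hp; rewrite /= !inordK ?resK // -hn.
  have := modz_ge0 (s i).1 (n_neq0 i); have := modz_ge0 (s j).1 (n_neq0 i); lia.
have {}hq : ((s i).2 %% n (s i))%Z = ((s j).2 %% n (s i))%Z.
  move/(congr1 val): hq; rewrite /= !inordK ?resK // -hn.
  have := modz_ge0 (s i).2 (n_neq0 i); have := modz_ge0 (s j).2 (n_neq0 i); lia.
have := v_decr _ _ ij; have := n_neq0 i; have vj0 := v_gt0 _ (sP j).1.
have {sP}[qi0 qj0] := ((sP i).1, (sP j).1).
case: (s i) (s j) hn hp hq qi0 qj0 vj0 => [p q] [p' q'].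
rewrite {h F FP s v_decr n_neq0 Kn resK v_gt0}/n /v /=.
move mD : (p ^+ 2 - _) =>
  m mE /eq_modz_dvdz /dvdzP [r rE] /eq_modz_dvdz /dvdzP [t tE].
move=> q0 q'0 vj0 m0 vv.
(* (p - q d) (p' + q' d) = m (x + y d) *)
pose x := 1 + r * p' - D%:Z * (t * q'); pose y := r * q' - t * p'.
have xE : m * x = p * p' - D%:Z * (q * q').
  have -> : p = p' + r * m by rewrite -rE; ring.
  have -> : q = q' + t * m by rewrite -tE; ring.
  have -> : m * x = m + m * (r * p' - D%:Z * (t * q')) by rewrite /x; ring.
  by rewrite {1}mE; ring.
have yE : m * y = p * q' - q * p'.
  have -> : p = p' + r * m by rewrite -rE; ring.
  have -> : q = q' + t * m by rewrite -tE; ring.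
  by rewrite /y; ring.
move: x y xE yE => x y xE yE.
have N1 : x ^+ 2 - D%:Z * y ^+ 2 = 1.
  apply: (mulfI (expf_neq0 2 m0)).
  transitivity ((m * x) ^+ 2 - D%:Z * (m * y) ^+ 2); first by ring.
  by rewrite xE yE mulr1 [RHS]expr2 -{1}mD mE; ring.
(* If y = 0 then x = 1 or -1. Multiplication by the conjugate p' + q' d then turns both q d - p and
   q' d - p' into m up to sign, so both pairs have the same [v], against its strict decrease. *)
have y0 : y != 0.
  apply/eqP => y0; have qq : p * q' = q * p' by lia.
  have x1 : `|x| = 1.
    move: N1; rewrite y0 expr0n mulr0 subr0 => /eqP; rewrite sqrf_eq1.
    by case/orP => /eqP ->.
  have : v (p, q) = v (p', q').
    have P'0 : p'%:~R + q'%:~R * d != 0.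
      apply: contra_neq m0 => E; apply/eqP; rewrite mE -(intr_eq0 R).
      rewrite intr_pell -dD.
      have -> : p'%:~R = - (q'%:~R * d) by apply/eqP; rewrite -subr_eq0 opprK E.
      by apply/eqP; ring.
    have /(congr1 (fun z : int => z%:~R : R)) := xE.
    have /(congr1 (fun z : int => z%:~R : R)) := qq.
    rewrite !(intrM, intrB) => qqR xER.
    apply: (mulIf (_ : `|p'%:~R + q'%:~R * d| != 0));
      first by rewrite normr_eq0.
    rewrite /v -!normrM /=.
    have -> : (q%:~R * d - p%:~R) * (p'%:~R + q'%:~R * d) =
      - (m%:~R * x%:~R) :> R.
      rewrite xER; ring: dD qqR.
    have -> : (q'%:~R * d - p'%:~R) * (p'%:~R + q'%:~R * d) = - m%:~R :> R.
      by rewrite mE intr_pell -dD; ring.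
    by rewrite !normrN normrM -(intr_norm _ x) x1 mulr1.
  by rewrite /v /= => E; rewrite E ltxx in vv.
exists `|x|, `|y|; split; rewrite ?normr_gt0 //;
  last by rewrite !real_normK ?num_real.
by apply/eqP => x0; move: N1; rewrite x0 expr0n; nia.
Qed.

(** * Irrational units *)

Section RealSubfield.
Context (R : realType) (F : {pred R}) (HF : divring_closed F).

Lemma subfield1 : 1 \in F. Proof. by case: HF. Qed.

Lemma subfieldB x y : x \in F -> y \in F -> x - y \in F.
Proof. by case: HF => _ + _; apply. Qed.

Lemma subfield_div x y : x \in F -> y \in F -> x / y \in F.
Proof. by case: HF => _ _; apply. Qed.

Lemma subfieldN x : x \in F -> - x \in F.
Proof.
by move=> xF; rewrite -sub0r -(subrr 1) !subfieldB ?subfield1.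
Qed.

Lemma subfieldD x y : x \in F -> y \in F -> x + y \in F.
Proof. by move=> xF yF; rewrite -[y]opprK subfieldB ?subfieldN. Qed.

Lemma subfieldM x y : x \in F -> y \in F -> x * y \in F.
Proof.
by move=> xF yF; rewrite -[y]invrK subfield_div // -div1r subfield_div
  ?subfield1.
Qed.

Lemma subfield_int (m : int) : m%:~R \in F.
Proof.
have nF (n : nat) : n%:R \in F.
  elim: n => [|n IH]; first by rewrite mulr0n -(subrr 1) subfieldB ?subfield1.
  by rewrite -addn1 natrD subfieldD ?subfield1.
by case: m => n; rewrite ?NegzE ?mulrNz -pmulrn ?subfieldN ?nF.
Qed.

Lemma subfield_rat (r : rat) : ratr r \in F.
Proof. by rewrite subfield_div ?subfield_int. Qed.

End RealSubfield.

(** Cramer's rule: the coordinates of [u'] and [v'] in the basis [u], [v] form an invertible matrix,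
    as F has dimension two. *)
Lemma rat_basis_independent (R : realType) (F : {pred R}) (u v u' v' : R) :
  rat_basis F u v -> u' \in F -> v' \in F -> rat_independent u' v' ->
  rat_basis F u' v'.
Proof.
move=> [_ _ _ gen] u'F v'F ind; split=> // x /gen[r [s ->]].
have [r1 [s1 E1]] := gen _ u'F; have [r2 [s2 E2]] := gen _ v'F.
have det0 : r1 * s2 - s1 * r2 != 0.
  apply/eqP => det0.
  (* This combination of [u'] and [v'] eliminates [v], the next one [u]. With determinant zero both
     vanish, which forces all four coordinates, and hence [u'], to be zero. *)
  have [] := ind s2 (- s1).
    rewrite E1 E2 rmorphN /=.
    transitivity (ratr (r1 * s2 - s1 * r2) * u).
      by rewrite rmorphB !rmorphM /=; ring.
    by rewrite det0 rmorph0 mul0r.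
  have [] := ind r2 (- r1).
    rewrite E1 E2 rmorphN /=.
    transitivity (- ratr (r1 * s2 - s1 * r2) * v).
      by rewrite rmorphB !rmorphM /=; ring.
    by rewrite det0 rmorph0 oppr0 mul0r.
  move=> r20 /eqP; rewrite oppr_eq0 => /eqP r10 s20 /eqP;
    rewrite oppr_eq0 => /eqP s10.
  have [|/eqP] := ind 1 0; last by rewrite oner_eq0.
  by rewrite E1 r10 s10 rmorph0; ring.
exists ((r * s2 - s * r2) / (r1 * s2 - s1 * r2)).
exists ((s * r1 - r * s1) / (r1 * s2 - s1 * r2)).
have det0' : ratr (r1 * s2 - s1 * r2) != 0 :> R by rewrite fmorph_eq0.
rewrite E1 E2 !fmorph_div /=; move: det0';
  rewrite !rmorphB !rmorphM /= => det0'.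
by field.
Qed.

(** Supplies the non-square [D] for Pell's equation. F has an irrational element w, since rational
    [u] and [v] would be dependent; as 1 and w form a basis, w satisfies a quadratic equation. *)
Lemma quadratic_field_sqrt (R : realType) (F : {pred R}) :
  real_quadratic_field F ->
  exists (d : R) (D : nat), [/\ d \in F, 0 < d, d ^+ 2 = D%:R &
    forall p q : int, p%:~R = q%:~R * d -> q = 0].
Proof.
move=> [HF [u [v B]]].
have [w wF wirr] : exists2 w, w \in F & forall r, w != ratr r.
  apply: contrapT => noirr.
  have ratF w : w \in F -> exists r, w = ratr r.
    move=> wF; apply: contrapT => wirr; apply: noirr; exists w => // r.
    by apply/eqP => wr; apply: wirr; exists r.
  have [uF vF ind _] := B; have [r ur] := ratF _ uF; have [s vs] := ratF _ vF.
  have [|s0 /eqP] := ind s (- r); first by rewrite ur vs rmorphN /=; ring.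
  rewrite oppr_eq0 => /eqP r0; have [|/eqP] := ind 1 0;
    last by rewrite oner_eq0.
  by rewrite ur r0 !rmorph0; ring.
have ind1w : rat_independent 1 w.
  move=> r s rs; have s0 : s = 0.
    apply/eqP; apply: contraT => s0.
    have s0' : ratr s != 0 :> R by rewrite fmorph_eq0.
    have /eqP[] := wirr (- r / s); rewrite fmorph_div rmorphN /=.
    by apply: (mulfI s0'); rewrite mulrCA mulfV // mulr1; lra.
  split => //; move/eqP: rs; rewrite s0 rmorph0 mul0r addr0 mulr1.
  by rewrite fmorph_eq0 => /eqP.
have [_ _ _ gen] := rat_basis_independent B (subfield1 HF) wF ind1w.
have [r [s ww]] := gen _ (subfieldM HF wF wF).
(* completing the square in w^2 = r + s w, and clearing denominators *)
pose n := denq (r + s ^+ 2 / 4); pose p := numq (r + s ^+ 2 / 4).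
have n0 : 0 < n by apply: denq_gt0.
have nR0 : n%:~R != 0 :> R by rewrite intr_eq0 gt_eqF.
pose d0 := n%:~R * (w - ratr (s / 2)).
have d0F : d0 \in F.
  by rewrite subfieldM ?subfield_int ?subfieldB ?subfield_rat.
have d02 : d0 ^+ 2 = (p * n)%:~R.
  have -> : (p * n)%:~R = n%:~R ^+ 2 * ratr (r + s ^+ 2 / 4) :> R.
    by rewrite /ratr -/n -/p intrM; field.
  rewrite rmorphD !fmorph_div rmorphXn /= !ratr_nat.
  rewrite /d0 exprMn; congr (_ * _).
  by rewrite fmorph_div /= ratr_nat sqrrB (expr2 w) ww; field.
have d0irr r' : d0 != ratr r'.
  apply: contra_neq (wirr (r' / n%:~R + s / 2)) => E.
  rewrite rmorphD fmorph_div /= ratr_int -E /d0 mulrAC mulfV // mul1r.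
  by rewrite subrK.
have pn0 : 0 <= p * n by rewrite -(ler0z R) -d02 sqr_ge0.
exists `|d0|, (absz (p * n)); split.
- by case: (ger0P d0); rewrite ?(subfieldN HF).
- by rewrite normr_gt0; have := d0irr 0; rewrite rmorph0.
- by rewrite real_normK ?num_real // d02 -{1}(gez0_abs pn0) -pmulrn.
move=> a b E; apply/eqP; apply: contraT => b0.
have bR0 : b%:~R != 0 :> R by rewrite intr_eq0.
have dE : `|d0| = ratr (a%:~R / b%:~R).
  by rewrite fmorph_div /= !ratr_int E mulrAC mulfV ?mul1r.
move: dE; case: (ger0P d0) => _ dE;
  first by have /eqP[] := d0irr (a%:~R / b%:~R).
by have /eqP[] := d0irr (- (a%:~R / b%:~R)); rewrite rmorphN /= -dE opprK.
Qed.

(** There are finitely many cosets, so those of [u ^+ i] and [u ^+ j] agree for some i < j, and then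
    [u ^+ (j - i)] lies in [H]. *)
Lemma finite_index_power (R : realType) (H G : set R) (u : R) :
  finite_index_subgroup H G -> u != 0 -> (forall n, G (u ^+ n)) ->
  exists2 k, (0 < k)%N & H (u ^+ k).
Proof.
move=> [_ H1 _ /finite_seqP[s sE]] u0 Gu.
pose C n : set R := [set u ^+ n * h | h in H].
have Cs n : C n \in s.
  have : [set` s] (C n) by rewrite -sE; exists (u ^+ n).
  by [].
pose idx n : 'I_(size s).+1 := inord (index (C n) s).
have [i [j [ij _ /(congr1 val)]]] := nat_pigeonhole idx.
rewrite /= !inordK ?ltnS ?index_size // => /(congr1 (nth set0 s)).
rewrite !nth_index // => Cij.
have : C i (u ^+ j) by rewrite Cij; exists 1; rewrite ?mulr1.
case=> h Hh uh; exists (j - i)%N; first by rewrite subn_gt0.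
suff -> : u ^+ (j - i) = h by [].
by apply: (mulfI (expf_neq0 i u0)); rewrite uh -exprD subnKC // ltnW.
Qed.

(** The inverse is the conjugate x - y d, and d is integral as a root of X^2 - D. *)
Lemma norm_one_unit (R : realType) (F : {pred R}) (d : R) (D : nat)
    (x y : int) :
  divring_closed F -> d \in F -> d ^+ 2 = D%:R ->
  x ^+ 2 - D%:Z * y ^+ 2 = 1 -> integer_units F (x%:~R + y%:~R * d).
Proof.
move=> HF dF dD N1.
have intdef z w : integralOver (intr : int -> R) (z%:~R + w%:~R * d).
  apply: integral_add; first exact: integral_id.
  apply: integral_mul; first exact: integral_id.
  apply: (@integral_root_monic _ _ _ _ ('X^2 - D%:R%:P)).
  - exact: monicXnsubC.
  - by rewrite /root !hornerE dD subrr.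
  - move=> c /(nthP 0)[i _ <-].
    rewrite coefB coefXn coefC; apply: integral_sub.
      exact: integral_nat.
    by case: eqP => _; [exact: integral_nat | exact: integral0].
have N1R : (x%:~R + y%:~R * d) * (x%:~R + (- y)%:~R * d) = 1.
  have /(congr1 (fun z : int => z%:~R : R)) := N1.
  by rewrite intr_pell -dD intrN mulr1z => E; rewrite -[RHS]E; ring.
have inF z w : z%:~R + w%:~R * d \in F.
  by rewrite subfieldD ?subfieldM ?subfield_int.
have u0 : x%:~R + y%:~R * d != 0.
  by apply: contra_eq_neq N1R => ->; rewrite mul0r eq_sym oner_neq0.
split; [exact: u0 | split; [exact: inF | exact: intdef] |].
have -> : (x%:~R + y%:~R * d)^-1 = x%:~R + (- y)%:~R * d.
  by apply: (mulfI u0); rewrite N1R mulfV.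
by split.
Qed.

Lemma finite_index_irrational (R : realType) (F : {pred R}) (H : set R) :
  real_quadratic_field F -> finite_index_subgroup H (integer_units F) ->
  exists2 alpha, H alpha & forall m : int, alpha != m%:~R.
Proof.
move=> hF hH; have [d [D [dF d0 dD irr]]] := quadratic_field_sqrt hF.
have [HF _] := hF.
have [x [y [x0 y0 N1]]] := pell_solution d0 dD irr.
set u := x%:~R + y%:~R * d.
(* The signs are carried through the induction so that the coefficient of d stays positive: no
   positive power of [u] is an integer. *)
have pow n : exists X Y : int,
    [/\ u ^+ n = X%:~R + Y%:~R * d, X ^+ 2 - D%:Z * Y ^+ 2 = 1, 0 < X, 0 <= Y
      & (0 < n)%N -> 0 < Y].
  elim: n => [|n [X [Y [uE N X0 Y0 _]]]].
    by exists 1, 0; split; rewrite ?expr0 //; ring.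
  exists (x * X + D%:Z * (y * Y)), (x * Y + y * X); split.
  - by rewrite exprS uE /u !(intrD, intrM) -pmulrn -dD; ring.
  - rewrite -[RHS]mulr1 -{1}N1 -N; ring.
  - by rewrite ltr_wpDr ?mulr_ge0 ?mulr_gt0 // ltW.
  - by rewrite addr_ge0 // mulr_ge0 // ltW.
  - by rewrite ltr_wpDl ?mulr_ge0 ?mulr_gt0 // ltW.
have u0 : u != 0.
  by rewrite gt_eqF // addr_gt0 ?mulr_gt0 ?ltr0z.
have [n|k k0 Hk] := finite_index_power hH u0.
  by have [X [Y [-> N _ _ _]]] := pow n; exact: norm_one_unit N.
exists (u ^+ k) => // m; have [X [Y [-> _ _ _ /(_ k0) Y0]]] := pow k.
apply: contraTneq Y0 => E.
by rewrite (irr (m - X) Y) ?ltxx // intrB -E; ring.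
Qed.

(** * The lattice and dense lines *)

Lemma int_latticeP (R : realType) (x : 'rV[R]_2) :
  x \in int_lattice R <-> forall i, exists m : int, x 0 i = m%:~R.
Proof.
rewrite int_latticeE; split=> [/mxOverP xL i | xL].
  by have /intrP[m ->] := xL 0 i; exists m.
by apply/mxOverP => i j; rewrite ord1; apply/intrP; have [m ->] := xL j;
  exists m.
Qed.

Lemma eq_torus_proj (R : realType) (x y : 'rV[R]_2) :
  torus_proj x = torus_proj y <-> x - y \in int_lattice R.
Proof. by rewrite Quotient.idealrBE; split=> /eqP. Qed.

Lemma norm_row_lt (R : realType) n (x : 'rV[R]_n) (e : R) : 0 < e ->
  (`|x| < e) <-> (forall i, `|x 0 i| < e).
Proof.
move=> e0; rewrite [`|x|]/Num.Def.normr /= mx_normrE; split=> [xe i|xe].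
  by apply: le_lt_trans xe; exact: (le_bigmax _ (fun i => `|x i.1 i.2|) (0, i)).
by apply: bigmax_lt => // -[i j] _ /=; rewrite ord1.
Qed.

(** Discreteness of Z^2, which makes continuous lattice-valued differences locally constant. *)
Lemma int_lattice_small (R : realType) (x : 'rV[R]_2) :
  x \in int_lattice R -> `|x| < 1 -> x = 0.
Proof.
move=> /int_latticeP xL /norm_row_lt x1; apply/rowP => i; rewrite mxE.
have := x1 ltr01 i; have [m ->] := xL i.
by rewrite -intr_norm -[1]/(1%:~R) ltr_int => ?; rewrite (_ : m = 0) //; lia.
Qed.

(** A coordinate that is not an integer keeps a positive distance from its floor and from the next
    integer, so Z^2 is closed. The limit arguments below rest on this. *)
Lemma int_lattice_adherent (R : realType) (x : 'rV[R]_2) :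
  (forall e, 0 < e -> exists2 y, y \in int_lattice R & `|x - y| < e) ->
  x \in int_lattice R.
Proof.
move=> xL; apply/int_latticeP => i; exists (Num.floor (x 0 i)).
apply/eqP; apply: contraT => xi.
have F1 := floor_le (x 0 i); have F2 := floorD1_gt (x 0 i).
set m := Num.floor _ in xi F1 F2.
rewrite intrD -[1%:~R]/(1 : R) in F2.
have {}F1 : m%:~R < x 0 i by rewrite lt_neqAle eq_sym xi F1.
pose e := Num.min (x 0 i - m%:~R) (m%:~R + 1 - x 0 i).
have e0 : 0 < e by rewrite lt_min !subr_gt0 F1 F2.
have [y /int_latticeP yL /(norm_row_lt _ e0)/(_ i)] := xL _ e0.
have [k yk] := yL i; rewrite !mxE yk lt_min !ltr_norml => /andP[/andP[_ h1]].
move=> /andP[h2 _].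
have : (m%:~R < k%:~R :> R) by lra.
have : (k%:~R < m%:~R + 1 :> R) by lra.
by rewrite -[1]/(1%:~R) -intrD !ltr_int; lia.
Qed.

Lemma int_lattice_proj_add (R : realType) (x m : 'rV[R]_2) :
  m \in int_lattice R -> torus_proj (x + m) = torus_proj x.
Proof. by move=> mL; apply/eq_torus_proj; rewrite addrC addKr. Qed.

(* Kronecker's theorem in dimension two: if |q b - p| is small and nonzero,
   where b = a 0 1 / a 0 0, its multiples approximate any real number. *)
Lemma line_lattice_dense (R : realType) (a x : 'rV[R]_2) (e : R) :
  rat_independent (a 0 0) (a 0 1) -> 0 < e ->
  exists (t : R) (m : 'rV[R]_2), m \in int_lattice R /\
    `|x - (t *: a + m)| < e.
Proof.
move=> ind e0.
have a0 : a 0 0 != 0.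
  apply/eqP => a0; have [|/eqP] := ind 1 0; last by rewrite oner_eq0.
  by rewrite a0 rmorph0; ring.
pose b := a 0 1 / a 0 0.
pose N := (Num.truncn e^-1).+1.
have eN : 1 < e * N%:R.
  by rewrite -(@ltr_pM2l _ e^-1) ?invr_gt0 // mulr1 mulKf ?gt_eqF // truncnS_gt.
have [p [q [q0 qN pq]]] := dirichlet_approximation b (ltn0Sn _ : (0 < N)%N).
set h := q%:R * b - p%:~R in pq.
have h0 : h != 0.
  rewrite /h /b subr_eq0; apply: contraTneq q0 => E.
  have [|_ /eqP] := ind (- p%:~R) q%:R.
    apply: (mulIf (invr_neq0 a0));
      rewrite mul0r mulrDl rmorphN /= ratr_int ratr_nat.
    by rewrite mulfK // -mulrA E; ring.
  by rewrite pnatr_eq0 => /eqP ->.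
have he : `|h| < e.
  rewrite ltNge; apply/negP => eh.
  have : e * N%:R <= `|h| * N%:R by rewrite ler_wpM2r.
  lra.
(* The time and lattice vector below match the first coordinate of [x] exactly and leave the error c
   - k h in the second; rounding c / h down makes it at most |h|. *)
pose c := x 0 1 - x 0 0 * b; pose k := Num.floor (c / h).
have ck : `|c - k%:~R * h| < e.
  apply: le_lt_trans he; rewrite -[X in X - _](divfK h0) -mulrBl normrM.
  rewrite ler_piMl //.
  have := floor_le (c / h); have := floorD1_gt (c / h).
  by rewrite -/k intrD -[1%:~R]/(1 : R) ler_norml => ? ?; lra.
pose m : 'rV[R]_2 := \row_j (if j == 0 then - (k * q%:Z)%:~R
  else - (k * p)%:~R).
exists ((x 0 0 + (k * q%:Z)%:~R) / a 0 0), m; split.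
  apply/int_latticeP => i; rewrite mxE -!intrN.
  by case: ifP => _; eexists.
apply/norm_row_lt => // i; rewrite !mxE.
case: i => [[|[|//]] ilt].
  have -> : Ordinal ilt = 0 by apply/val_inj.
  rewrite eqxx mulfVK // (_ : _ - _ = 0) ?normr0 //; ring.
have -> : Ordinal ilt = 1 by apply/val_inj.
rewrite /= (_ : _ - _ = c - k%:~R * h) // /c /h /b !intrM -pmulrn.
by field.
Qed.

(** * Lifts of torus maps *)

(** The difference of the two maps is continuous at [x] with values in a discrete lattice near [x],
    hence constant there. *)
Lemma derive_congruent (R : realType) (V : normedModType R)
    (g1 g2 : V -> 'rV[R]_2)
    (x v : V) :
  differentiable g1 x -> differentiable g2 x ->
  (\forall y \near x, g1 y - g2 y \in int_lattice R) ->
  'D_v g1 x = 'D_v g2 x.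
Proof.
move=> d1 d2 L12.
have cont : {for x, continuous (g1 - g2)}.
  by apply: differentiable_continuous; apply: differentiableB.
have eq12 : \forall y \near x, g1 y = (g2 + cst (g1 x - g2 x)) y.
  have /cvgrPdist_lt/(_ 1 ltr01) near1 := cont.
  near=> y; apply/eqP; rewrite -subr_eq0; apply/eqP.
  have -> : g1 y - (g2 + cst (g1 x - g2 x)) y = - ((g1 - g2) x - (g1 - g2) y).
    rewrite -[(g2 + _) y]/(g2 y + (g1 x - g2 x)) -[(g1 - g2) x]/(g1 x - g2 x).
    by rewrite -[(g1 - g2) y]/(g1 y - g2 y) [RHS]opprB opprD addrA.
  apply: int_lattice_small; last by rewrite normrN; near: y.
  rewrite rpredN rpredB //; first exact: (nbhs_singleton L12).
  by near: y.
rewrite (near_eq_derive _ eq12) deriveD; last 2 first.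
- exact: diff_derivable.
- exact: derivable_cst.
by rewrite derive_cst addr0.
Unshelve. all: by end_near. Qed.

Lemma derive_line (R : realType) (V W : normedModType R) (g : V -> W)
    (x a : V) (t : R) :
  differentiable g (x + t *: a) ->
  differentiable (fun s : R => g (x + s *: a)) t /\
  'D_1 (fun s : R => g (x + s *: a)) t = 'D_a g (x + t *: a).
Proof.
move=> dg.
have did : is_diff t (id : R -> R) id := is_diff_id t.
pose l := cst x + (fun s : R => s *: a).
have dscal : differentiable (fun s : R => s *: a) t.
  by apply: differentiableZl; exact: (@ex_diff _ _ _ _ _ _ _ did).
have dl : differentiable l t by apply: differentiableD.
have Dl : 'd l t 1 = a.
  rewrite diffD // diff_cst diffZl; last exact: (@ex_diff _ _ _ _ _ _ _ did).
  by rewrite /= -[LHS]/(0 + 'd id t 1 *: a) add0r (@diff_val _ _ _ _ _ _ _ did)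
    scale1r.
have dgl : differentiable (g \o l) t := differentiable_comp dl dg.
by split; [exact: dgl | rewrite deriveE // diff_comp //= Dl deriveE].
Qed.

Lemma derive0_segment (R : realType) n (h : R -> 'rV[R]_n) (u v : R) :
  u <= v -> (forall s, s \in `[u, v] -> differentiable h s /\ 'D_1 h s = 0) ->
  h u = h v.
Proof.
move=> uv dh; apply/rowP => i.
have dhi s : s \in `[u, v] -> is_derive s 1 (fun s => h s 0 i) 0.
  move=> /dh[dhs /esym Ds];
    have dhs' : derivable h s 1 by exact: diff_derivable.
  apply: DeriveDef; first by move/derivable_mxP: dhs'; apply.
  by move/rowP/(_ i): Ds; rewrite derive_mx // !mxE.
pose f s := h s 0 i.
have cont : {within `[u, v], continuous f}.
  apply: derivable_within_continuous => s /dhi df.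
  exact: (@ex_derive _ _ _ _ _ _ _ df).
have df s : s \in `]u, v[ -> is_derive s 1 f (cst 0 s).
  by move=> /subset_itv_oo_cc /dhi.
have [s _] := MVT_segment uv df cont.
by rewrite /= mul0r => /eqP; rewrite subr_eq0 => /eqP/esym.
Qed.

(** The set where [P] holds is open and closed, and the real line is connected. *)
Lemma locally_constant_prop (R : realType) (P : R -> Prop) :
  (forall t, \forall s \near t, P s <-> P t) -> forall t s, P t -> P s.
Proof.
move=> lc t s Pt.
have con : connected [set: R] by apply/connected_intervalP => ? ?.
suff PT : [set r | P r] = setT by have : [set: R] s by []; rewrite -PT.
apply: con; first by exists t.
- exists [set r | P r]; last by rewrite setTI.
  by rewrite openE => r /= Pr; apply: filterS (lc r) => r' /=; tauto.
- exists [set r | P r]; last by rewrite setTI.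
  move=> r clr /=; have [r' [Pr']] := clr _ (lc r).
  by tauto.
Qed.

(** * Rigidity of lifts that multiply a constant field by a scalar *)

Section LatticeLift.
(** [G] is a set-theoretic lift of a torus map and may jump by lattice vectors; regularity is
    carried by local lifts [g] congruent to it modulo the lattice. *)
Context (R : realType) (G : 'rV[R]_2 -> 'rV[R]_2) (a : 'rV[R]_2) (alpha : R).
Hypothesis G_lattice : forall x m, m \in int_lattice R ->
  G (x + m) - G x \in int_lattice R.
Hypothesis G_local : forall x,
  exists (U : set 'rV[R]_2) (g : 'rV[R]_2 -> 'rV[R]_2),
  [/\ open U, U x, forall y, U y -> differentiable g y &
      forall y, U y -> g y - G y \in int_lattice R].
Hypothesis G_tangent : forall x, exists g : 'rV[R]_2 -> 'rV[R]_2,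
  [/\ differentiable g x, 'D_a g x = alpha *: a &
      \forall y \near x, g y - G y \in int_lattice R].

Lemma local_lift_tangent (U : set 'rV[R]_2) (g : 'rV[R]_2 -> 'rV[R]_2) x :
  open U -> U x -> differentiable g x ->
  (forall y, U y -> g y - G y \in int_lattice R) -> 'D_a g x = alpha *: a.
Proof.
move=> oU Ux dg gG; have [g' [dg' <- g'G]] := G_tangent x.
apply: derive_congruent => //; near=> y.
have -> : g y - g' y = (g y - G y) - (g' y - G y) by rewrite opprB addrA subrK.
by apply: rpredB; [apply: gG|]; near: y => //; exact: open_nbhs_nbhs.
Unshelve. all: by end_near. Qed.

(** Along the orbit, a local lift minus [(s * alpha) *: a] has derivative zero. The congruence is
    therefore locally constant in [t], and it holds at time 0. *)
Lemma orbit_image x t :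
  G (x + t *: a) - G x - (t * alpha) *: a \in int_lattice R.
Proof.
pose P t := G (x + t *: a) - G x - (t * alpha) *: a \in int_lattice R.
suff lc : forall t, \forall s \near t, P s <-> P t.
  apply: (locally_constant_prop lc (t := 0)).
  by rewrite /P !(scale0r, mul0r) addr0 subrr subr0 rpred0.
move=> {}t; have [U [g [oU Ut dg gG]]] := G_local (x + t *: a).
have [e /= e0 eU] : \forall s \near t, U (x + s *: a).
  have cl : {for t, continuous (fun s : R => x + s *: a)}.
    by apply: cvgD; [exact: cvg_cst | apply: cvgZr_tmp; exact: cvg_id].
  by apply: cl; apply: open_nbhs_nbhs.
pose c (s : R) : 'rV[R]_2 := (s * alpha) *: a.
pose h := (fun s : R => g (x + s *: a)) - (fun s : R => 0 + s *: (alpha *: a)).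
have hE s : h s = g (x + s *: a) - (s * alpha) *: a.
  by rewrite /h -[LHS]/(g (x + s *: a) - (0 + s *: (alpha *: a))) add0r scalerA.
have h0 u v : u <= v -> ball t e u -> ball t e v -> h u = h v.
  move=> uv tu tv; apply: derive0_segment uv _ => s;
    rewrite in_itv /= => /andP[us sv].
  have Us : U (x + s *: a).
    apply: eU; move: tu tv; rewrite /ball /= !ltr_norml => ? ?; lra.
  have [d1 D1] := derive_line (dg _ Us).
  have [d2 D2] := @derive_line _ _ _ id 0 (alpha *: a) s
    (@ex_diff _ _ _ _ _ _ _ (is_diff_id _)).
  split; first exact: differentiableB.
  rewrite deriveB; [|exact: diff_derivable..].
  by rewrite D1 D2 (local_lift_tangent oU Us (dg _ Us) gG) derive_id subrr.
exists e => //= s ts.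
have tt : ball t e t by apply: ballxx.
have hst : h s = h t.
  by have [le_st|/ltW le_ts] := leP s t; [exact: h0 | apply/esym; exact: h0].
have PE r : ball t e r -> P r = (h r - G x \in int_lattice R).
  move=> tr; rewrite /P hE.
  have gr := gG _ (eU _ tr).
  have -> : G (x + r *: a) - G x - (r * alpha) *: a = g (x + r *: a)
      - (r * alpha) *: a - G x - (g (x + r *: a) - G (x + r *: a)).
    by apply/rowP => i; rewrite !mxE; ring.
  by rewrite rpredBr.
by rewrite !PE // hst.
Qed.

Hypothesis ind : rat_independent (a 0 0) (a 0 1).

(* The identity holds for y in the dense subgroup R a + Z^2, hence for all y
   by continuity of the local lifts. *)
Lemma lift_affine x y : G (x + y) - G x - (G y - G 0) \in int_lattice R.
Proof.
have dense_case z t m : m \in int_lattice R ->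
    G (z + (t *: a + m)) - G z - (t * alpha) *: a \in int_lattice R.
  move=> mL; have -> : G (z + (t *: a + m)) - G z - (t * alpha) *: a =
      (G (z + t *: a + m) - G (z + t *: a)) +
      (G (z + t *: a) - G z - (t * alpha) *: a).
    by rewrite addrA; apply/rowP => i; rewrite !mxE; ring.
  by rewrite rpredD ?G_lattice ?orbit_image.
apply: int_lattice_adherent => e e0.
have [U [g [oU Uxy dg gG]]] := G_local (x + y).
have [U' [g' [oU' U'y dg' g'G]]] := G_local y.
have cxy : {for y, continuous (fun z => x + z)}.
  apply: continuousD; [exact: cst_continuous | exact: cvg_id].
have cg : {for y, continuous (fun z => g (x + z))}.
  apply: (@continuous_comp _ _ _ (fun z => x + z) g) => //.
  by apply: differentiable_continuous; apply: dg.
have cg' : {for y, continuous g'} by apply: differentiable_continuous;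
  apply: dg'.
have e2 : 0 < e / 2 by rewrite divr_gt0.
have /nbhs_ballP[r /= r0 near_y] : \forall z \near y, [/\ U (x + z), U' z,
    `|g (x + y) - g (x + z)| < e / 2 & `|g' y - g' z| < e / 2].
  near=> z; split; near: z.
  - by apply: cxy; apply: open_nbhs_nbhs.
  - exact: open_nbhs_nbhs.
  - by have /cvgrPdist_lt := cg; apply.
  - by have /cvgrPdist_lt := cg'; apply.
have [t [m [mL]]] := line_lattice_dense y ind r0.
set z := _ + m => yz; have [Uz U'z gz g'z] : [/\ U (x + z), U' z,
    `|g (x + y) - g (x + z)| < e / 2 & `|g' y - g' z| < e / 2].
  by apply: near_y; rewrite -ball_normE.
(* The defect at [y] is corrected by the increments of [g] and [g'] between [z] and [y]. These are
   small by continuity, and the corrected vector is in the lattice by [dense_case] at [x] and at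
   0. *)
exists (G (x + y) - G x - (G y - G 0) - (g (x + y) - g (x + z))
  + (g' y - g' z)).
  have -> : G (x + y) - G x - (G y - G 0) - (g (x + y) - g (x + z))
      + (g' y - g' z)
      = (G (x + z) - G x - (t * alpha) *: a)
      - (G (0 + z) - G 0 - (t * alpha) *: a)
      + ((g (x + z) - G (x + z)) - (g (x + y) - G (x + y)))
      + ((g' y - G y) - (g' z - G z)).
    by rewrite add0r; apply/rowP => i; rewrite !mxE; ring.
  apply: rpredD; last by apply: rpredB; apply: g'G.
  apply: rpredD; last by apply: rpredB; apply: gG.
  by apply: rpredB; apply: dense_case.
set w := _ - (G y - G 0);
  rewrite (_ : w - _ = (g (x + y) - g (x + z)) - (g' y - g' z)).
  by apply: le_lt_trans (ler_normB _ _) _; rewrite [e]splitr ltrD.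
by apply/rowP => i; rewrite !mxE; ring.
Unshelve. all: by end_near. Qed.

Lemma lift_affineMn y n : G (y *+ n) - G 0 - (G y - G 0) *+ n \in int_lattice R.
Proof.
elim: n => [|n IH]; first by rewrite !mulr0n !subrr rpred0.
have -> : G (y *+ n.+1) - G 0 - (G y - G 0) *+ n.+1 =
    (G (y *+ n + y) - G (y *+ n) - (G y - G 0)) +
    (G (y *+ n) - G 0 - (G y - G 0) *+ n).
  by rewrite !mulrSr; move: (_ *+ n) => w; apply/rowP => i; rewrite !mxE; ring.
by rewrite rpredD ?lift_affine.
Qed.

(* For a lattice vector m and a local lift g at 0, N (g (m / N) - g 0) lies in
   the lattice for large N and tends to the derivative of g along m. *)
Lemma derivative_preserves_lattice : exists L : {linear 'rV[R]_2 -> 'rV[R]_2},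
  L a = alpha *: a /\ forall m, m \in int_lattice R -> L m \in int_lattice R.
Proof.
have [U [g [oU U0 dg gG]]] := G_local 0; exists ('d g 0); split=> [|m mL].
  by rewrite -deriveE ?(local_lift_tangent oU) //; apply: dg.
rewrite -deriveE; last exact: dg.
apply: int_lattice_adherent => e e0.
have /cvgrPdist_lt/(_ e e0) near_e := diff_derivable (v := m) (dg _ U0).
have U_near : \forall h \near (0 : R)^', U (h *: m).
  apply: nbhs_dnbhs; have : {for 0, continuous (fun h : R => h *: m)}.
    by apply: cvgZr_tmp; exact: cvg_id.
  by apply; rewrite scale0r; apply: open_nbhs_nbhs.
have [r /= r0 near_r] : \forall h \near (0 : R)^', U (h *: m) /\
    `|'D_m g 0 - h^-1 *: (g (h *: m + 0) - g 0)| < e.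
  by apply: filterI.
pose n := Num.truncn r^-1.
have nr : n.+1%:R^-1 < r by rewrite invf_plt ?posrE ?ltr0Sn // truncnS_gt.
have [||Um em] := near_r n.+1%:R^-1.
- by rewrite /ball /= sub0r normrN gtr0_norm // invr_gt0.
- by rewrite invr_eq0 pnatr_eq0.
exists (n.+1%:R^-1^-1 *: (g (n.+1%:R^-1 *: m + 0) - g 0)) => //.
rewrite invrK addr0; set y := _ *: m in Um *.
have ym : y *+ n.+1 = m.
  by rewrite -scaler_nat /y scalerA mulfV ?scale1r ?pnatr_eq0.
(* With N = n + 1 and N y = m, the difference quotient N (g y - g 0) is congruent to G (N y) - G 0
   by affinity, and G m - G 0 is a lattice vector. *)
rewrite scaler_nat; have -> : (g y - g 0) *+ n.+1 =
   ((g y - G y) - (g 0 - G 0)) *+ n.+1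
   - (G (y *+ n.+1) - G 0 - (G y - G 0) *+ n.+1)
   + (G (0 + m) - G 0).
  rewrite ym add0r; move: (G m - G 0) => P.
  rewrite [- (P - _)]opprB addrA subrK -mulrnDl.
  by congr (_ *+ _); apply/rowP => i; rewrite !mxE; ring.
apply: rpredD; last exact: G_lattice.
apply: rpredB; last exact: lift_affineMn.
by apply: rpredMn; apply: rpredB; apply: gG.
Qed.

End LatticeLift.

(** * Linear parts of the symmetries of the flow *)

Lemma torus_proj_repr (R : realType) (p : torus R) : torus_proj (repr p) = p.
Proof. exact: reprK. Qed.

Lemma symmetry_linear_part (R : realType) (f : torus_diffeo R) (a : 'rV[R]_2)
    (alpha : R) :
  rat_independent (a 0 0) (a 0 1) ->
  (forall q, tangent_map f q a = alpha *: a) ->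
  exists L : {linear 'rV[R]_2 -> 'rV[R]_2},
    L a = alpha *: a /\ forall m, m \in int_lattice R -> L m \in int_lattice R.
Proof.
move=> ind Tf; pose G (x : 'rV[R]_2) : 'rV[R]_2 := repr (f (torus_proj x)).
have liftE (x z : 'rV[R]_2) :
    torus_proj z = f (torus_proj x) <-> z - G x \in int_lattice R.
  by rewrite -eq_torus_proj torus_proj_repr.
have G_local x : exists (U : set 'rV[R]_2) (g : 'rV[R]_2 -> 'rV[R]_2),
    [/\ open U, U x, forall y, U y -> differentiable g y &
        forall y, U y -> g y - G y \in int_lattice R].
  have [U [g [oU Ux sg gf]]] := diffeo_smooth f x.
  exists U, g; split=> // y Uy; first by have [dg _] := sg 1%N; apply: dg.
  by apply/liftE; apply: gf.
apply: (@derivative_preserves_lattice _ G) => // [x m mL|x].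
  by rewrite /G int_lattice_proj_add // subrr rpred0.
(* A differentiable local lift exists, so [tangent_map] is a genuine differential and not the
   default value 0. *)
have [g [ng dg LE]] : [set L : 'rV[R]_2 -> 'rV[R]_2 |
    exists g : 'rV[R]_2 -> 'rV[R]_2,
    [/\ (\forall y \near repr (torus_proj x),
          torus_proj (g y) = f (torus_proj y)),
        differentiable g (repr (torus_proj x)) &
        L = 'd g (repr (torus_proj x)) :> ('rV[R]_2 -> 'rV[R]_2)]]
    (tangent_map f (torus_proj x)).
  rewrite /tangent_map /torus_diff.
  apply: (xgetPex (fun=> 0)).
  have [U [g [oU Ux dg gG]]] := G_local (repr (torus_proj x)).
  exists (fun v => 'd g (repr (torus_proj x)) v), g; split=> //; last exact: dg.
  apply: filterS (open_nbhs_nbhs (conj oU Ux)) => y Uy.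
  by apply/liftE; apply: gG.
(* [tangent_map] is computed at the chosen representative, which differs from [x] by the lattice
   vector [s]; translating the lift by [s] carries it to [x]. *)
pose s := x - repr (torus_proj x).
have sL : s \in int_lattice R by apply/eq_torus_proj; rewrite torus_proj_repr.
have xs : x - s = repr (torus_proj x) by rewrite opprB addrC subrK.
rewrite -xs in ng dg LE; exists (fun y => g (y - s)); split.
- apply: (@differentiable_comp _ _ _ _ (fun y => y - s) g) => //.
- rewrite -(Tf (torus_proj x)) LE -deriveE // /derive.
  set d := (fun _ : R => _); set d' := (fun _ : R => _).
  by suff -> : d = d' by []; apply/funext => h; rewrite /d /d' /= addrA.
have cs : {for x, continuous (fun y : 'rV[R]_2 => y - s)}.
  by apply: continuousB; [exact: cvg_id | exact: cst_continuous].
have {}ng : \forall y \near x, torus_proj (g (y - s)) = f (torus_proj (y - s)).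
  exact: (cs _ ng).
apply: filterS ng => y /= gy; apply/liftE.
by rewrite gy -(int_lattice_proj_add (y - s) sL) subrK.
Qed.

Lemma multiplier_linear_part (R : realType) (psi : R -> torus R -> torus R)
    (a : 'rV[R]_2) (alpha : R) :
  generating_field psi = constant_field a ->
  rat_independent (a 0 0) (a 0 1) -> multiplier_group psi alpha ->
  exists L : {linear 'rV[R]_2 -> 'rV[R]_2},
    L a = alpha *: a /\ forall m, m \in int_lattice R -> L m \in int_lattice R.
Proof.
move=> psia ind [f [beta b0 fb] <-].
(* Since [f] is a symmetry, the set defining [multiplier] is nonempty, so the chosen value satisfies
   the equation. *)
have [_] : [set alpha : R | alpha != 0 /\ pushforward f (generating_field psi) =
    fun p => alpha *: generating_field psi p] (multiplier psi f).
  by apply: (xgetPex 0); exists beta.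
rewrite psia => E; apply: (symmetry_linear_part (f := f)) => // q.
(* Evaluation at [f q] makes [q] the base point of the tangent map in the push-forward. *)
have := congr1 (fun X : vector_field R => X (f q)) E.
by rewrite /pushforward /constant_field diffeo_funK.
Qed.

Theorem theorem4p3 (R : realType) (psi : R -> torus R -> torus R)
    (F : {pred R}) (hpsi : quasiperiodic_flow psi)
    (hF : real_quadratic_field F)
    (hM : finite_index_subgroup (multiplier_group psi) (integer_units F)) :
  algebraic_flow F psi.
Proof.
split=> //; have [_ [a [psia ind]]] := hpsi; exists a; split=> //.
have [alpha Malpha alpha_irr] := finite_index_irrational hF hM.
have [HF [u [v basisF]]] := hF.
have alphaF : alpha \in F.
  by have [/(_ _ Malpha) [_ []]] := hM.
have [L [La LZ]] := multiplier_linear_part psia ind Malpha.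
have a0 : a 0 0 != 0.
  apply/eqP => a0; have [|/eqP] := ind 1 0; last by rewrite oner_eq0.
  by rewrite a0 rmorph0; ring.
have delta_lattice j : delta_mx 0 j \in int_lattice R.
  apply/int_latticeP => i; rewrite mxE eqxx /=.
  by case: (i == j); [exists 1 | exists 0].
(* [b] and [c] are the first coordinates of the images of the two standard basis vectors; the first
   coordinate of L a = alpha a then gives [Ea]. *)
have /int_latticeP/(_ 0)[b bE] := LZ _ (delta_lattice 0).
have /int_latticeP/(_ 0)[c cE] := LZ _ (delta_lattice 1).
have Ea : alpha * a 0 0 = a 0 0 * b%:~R + a 0 1 * c%:~R.
  have /rowP/(_ 0) := La; rewrite [in LHS](row_sum_delta a).
  rewrite !big_ord_recl big_ord0 addr0 linearD !linearZ /= !mxE.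
  rewrite (_ : lift 0 0 = 1 :> 'I_2) ?bE ?cE //; last exact/val_inj.
have c0 : c%:~R != 0 :> R.
  apply: contraNneq (alpha_irr b) => c0; apply/eqP/(mulIf a0).
  by rewrite Ea c0; ring.
have slope : a 0 1 / a 0 0 = (alpha - b%:~R) / c%:~R.
  by apply: (mulIf a0); apply: (mulIf c0); rewrite divfK // mulrAC divfK //;
    lra.
(* This scaling turns the pair into 1 and the slope, both in F. *)
exists (a 0 0)^-1; first by rewrite invr_eq0.
apply: (rat_basis_independent basisF).
- by rewrite mulVf // subfield1.
- by rewrite mulrC slope subfield_div ?subfieldB ?subfield_int.
move=> r s rs; apply: ind.
have := congr1 (fun z => a 0 0 * z) rs; rewrite mulr0 => <-.
by field.
Qed.
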